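(* Let $f:A\longrightarrow C$ be a homomorphism of abelian groups. Then the fiber change maps $f_*:B^A(G)\longrightarrow B^C(G)$, for all finite groups $G$, define a morphism of biset functors $B^A\to B^C$ if and only if $f$ is injective on the torsion subgroup $\mathrm{tor}(A)$.
   Context: For a finite group $G$ and an abelian group $A$: a finite $A$-fibered $G$-set is a $G\times A$-set with finitely many orbits on which $A$ acts freely. $B^A(G)$ is the Grothendieck group (ring) of finite $A$-fibered $G$-sets with respect to disjoint union. It is the free abelian group on the isomorphism classes of transitive $A$-fibered $G$-sets; these correspond to $G$-orbits $[K,\phi]_G$ of pairs $(K,\phi)$, $K\le G$, $\phi\in\mathrm{Hom}(K,A)$, under the conjugation ${}^g(K,\phi)=(gKg^{-1},{}^g\phi)$, ${}^g\phi(x)=\phi(g^{-1}xg)$, where $[K,\phi]_G$ is the class of $(G\times A)/\{(k,\phi(k)) : k\in K\}$. Fiber change map: for a homomorphism $f:A\to C$, $f_*:B^A(G)\to B^C(G)$ is the additive map sending $[K,\phi]_G$ to $[K,f\circ\phi]_G$. Biset functor structure: for a finite $(H,G)$-biset $U$ ($H,G$ finite groups) and an $A$-fibered $G$-set $X$, let $U\times_G X$ be the quotient of $U\times X$ by $(ug,x)\sim(u,gx)$, with its natural $H\times A$-action, and let $U\otimes_G X$ be the sub-$H\times A$-set of all elements having trivial stabilizer in $A$. This induces an additive map $B^A(U):B^A(G)\to B^A(H)$, additive in $U$ and functorial for composition of bisets, making $B^A$ a biset functor, i.e. an additive functor to abelian groups from the biset category $\mathcal{C}$ (objects finite groups; $\mathrm{Hom}_{\mathcal{C}}(G,H)=B(H,G)$,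 the Grothendieck group of finite $(H,G)$-bisets). The maps $f_*$ define a morphism of biset functors when $f_*\circ B^A(U)=B^C(U)\circ f_*$ for all finite groups $G,H$ and all finite $(H,G)$-bisets $U$. *)

(* Defs.v *)
From HB Require Import structures.
From mathcomp Require Import all_boot all_order all_algebra all_fingroup.
From mathcomp Require Import boolp classical_sets functions cardinality fsbigop.
From mathcomp Require Import generic_quotient freeg.

Set Implicit Arguments.
Unset Strict Implicit.
Unset Printing Implicit Defensive.

Import GRing.Theory.

Local Open Scope ring_scope.
Local Open Scope quotient_scope.

                                                                                

                                                                
Record gaset (G : finGroupType) (A : zmodType) := GASet {
  ga_car :> choiceType;
  ga_act : G -> A -> ga_car -> ga_car;
  ga_act1 : forall x, ga_act 1%g 0 x = x;
  ga_actM : forall g h a b x,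
    ga_act (g * h)%g (a + b) x = ga_act g a (ga_act h b x) }.

Section GASets.
Variables (G : finGroupType) (A : zmodType).
Implicit Types (X Y : gaset G A).

Definition orbit_rel X (x y : X) : bool :=
  `[< exists g a, y = ga_act g a x >].

Lemma orbit_relP X (x y : X) :
  reflect (exists g a, y = ga_act g a x) (orbit_rel x y).
Proof. exact: asboolP. Qed.

Lemma ga_actK X g a (x : X) : ga_act g^-1%g (- a) (ga_act g a x) = x.
Proof. by rewrite -ga_actM mulVg addNr ga_act1. Qed.

Lemma ga_actVK X g a (x : X) : ga_act g a (ga_act g^-1%g (- a) x) = x.
Proof. by rewrite -ga_actM mulgV subrr ga_act1. Qed.

Lemma orbit_rel_refl X : reflexive (@orbit_rel X).
Proof. by move=> x; apply/orbit_relP; exists 1%g, 0; rewrite ga_act1. Qed.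

Lemma orbit_rel_sym X : symmetric (@orbit_rel X).
Proof.
suff h (x y : X) : orbit_rel x y -> orbit_rel y x.
  by move=> x y; apply/idP/idP; apply: h.
case/orbit_relP=> g [a ->]; apply/orbit_relP.
by exists g^-1%g, (- a); rewrite ga_actK.
Qed.

Lemma orbit_rel_trans X : transitive (@orbit_rel X).
Proof.
move=> y x z /orbit_relP[g [a ->]] /orbit_relP[h [b ->]]; apply/orbit_relP.
by exists (h * g)%g, (b + a); rewrite ga_actM.
Qed.

Canonical orbit_equiv X :=
  EquivRel (@orbit_rel X) (@orbit_rel_refl X) (@orbit_rel_sym X)
           (@orbit_rel_trans X).

Definition orbit_space X := {eq_quot @orbit_equiv X}.

HB.instance Definition _ X := EqQuotient.on (orbit_space X).
HB.instance Definition _ X := Choice.on (orbit_space X).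

Definition finitely_many_orbits X := finite_set [set: orbit_space X]%classic.

Definition trivial_fiber_stabilizer X (x : X) : Prop :=
  forall a, ga_act 1%g a x = x -> a = 0.

Lemma orbit_pi X (x y : X) :
  (\pi_(orbit_space X) x == \pi_(orbit_space X) y) = orbit_rel x y.
Proof. by rewrite eqmodE. Qed.

Lemma finitely_many_orbitsP X :
  finitely_many_orbits X <->
  exists s : seq X, forall x, exists2 y, y \in s & orbit_rel y x.
Proof.
split=> [/finite_seqP[s sE]|[s sP]].
  exists [seq repr o | o <- s] => x; exists (repr (\pi_(orbit_space X) x)).
    have : [set: orbit_space X]%classic (\pi x) by [].
    by rewrite sE => /= ?; apply/mapP; exists (\pi x).
  by rewrite -orbit_pi reprK.
apply/finite_seqP; exists [seq \pi_(orbit_space X) x | x <- s].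
apply/seteqP; split=> // o _ /=.
have [y ys yo] := sP (repr o); apply/mapP; exists y => //.
by apply/eqP; rewrite eq_sym -[o]reprK orbit_pi.
Qed.

End GASets.

Section InvariantSubset.
Variables (G : finGroupType) (A : zmodType) (X : gaset G A) (P : pred X).
Hypothesis P_act : forall g a x, P x -> P (ga_act g a x).

Definition sub_act g a (z : {x : X | P x}) : {x : X | P x} :=
  exist _ (ga_act g a (val z)) (P_act g a (valP z)).

Lemma sub_act1 z : sub_act 1%g 0 z = z.
Proof. by apply: val_inj; rewrite /= ga_act1. Qed.

Lemma sub_actM g h a b z :
  sub_act (g * h)%g (a + b) z = sub_act g a (sub_act h b z).
Proof. by apply: val_inj; rewrite /= ga_actM. Qed.

Definition sub_gaset : gaset G A := GASet sub_act1 sub_actM.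

Lemma orbit_rel_sub (y z : sub_gaset) :
  orbit_rel y z = orbit_rel (val y) (val z).
Proof.
apply/orbit_relP/orbit_relP => -[g [a]] => [->|h]; exists g, a => //.
exact: val_inj.
Qed.

Lemma sub_fin : finitely_many_orbits X -> finitely_many_orbits sub_gaset.
Proof.
move=> /finitely_many_orbitsP[s sP]; apply/finitely_many_orbitsP.
exists (pmap insub s) => z; have [y ys yz] := sP (val z).
have Py : P y.
  move: yz; rewrite orbit_rel_sym => /orbit_relP[g [a ->]].
  exact/P_act/valP.
exists (exist _ y Py); last by rewrite orbit_rel_sub.
by rewrite mem_pmap_sub.
Qed.

End InvariantSubset.

                             
Record fibset (G : finGroupType) (A : zmodType) := FibSet {
  fib_set :> gaset G A;
  fib_free : forall x : fib_set, trivial_fiber_stabilizer x;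
  fib_fin : finitely_many_orbits fib_set }.

Definition gaset_iso G A (X Y : gaset G A) : Prop :=
  exists2 F : X -> Y, bijective F &
    forall g a x, F (ga_act g a x) = ga_act g a (F x).

                                                                                
                                                                                
Section CharPairs.
Variables (G : finGroupType) (A : zmodType).

Definition is_charpair (p : {group G} * {ffun G -> A}) : bool :=
  [forall x in p.1, forall y in p.1, p.2 (x * y)%g == p.2 x + p.2 y]
  && [forall x, (x \notin p.1) ==> (p.2 x == 0)].

Record charpair := CharPair { cp_val; _ : is_charpair cp_val }.

HB.instance Definition _ := [isSub for cp_val].
HB.instance Definition _ := [Choice of charpair by <:].

Definition cp_grp (p : charpair) : {group G} := (val p).1.
Definition cp_hom (p : charpair) : {ffun G -> A} := (val p).2.

Lemma is_charpairP (p : {group G} * {ffun G -> A}) :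
  reflect ((forall x y, x \in p.1 -> y \in p.1 ->
              p.2 (x * y)%g = p.2 x + p.2 y) /\
           (forall x, x \notin p.1 -> p.2 x = 0)) (is_charpair p).
Proof.
apply: (iffP andP) => [[h1 h2]|[h1 h2]]; split.
- move=> x y xp yp.
  exact/eqP/(forall_inP (forall_inP h1 x xp)).
- by move=> x xp; apply/eqP/(implyP (forallP h2 x)).
- by apply/forall_inP=> x xp; apply/forall_inP=> y yp; rewrite h1.
- by apply/forallP=> x; apply/implyP=> /h2 ->.
Qed.

Lemma cp_homM (p : charpair) x y : x \in cp_grp p -> y \in cp_grp p ->
  cp_hom p (x * y)%g = cp_hom p x + cp_hom p y.
Proof. by case: p => q hq; have /is_charpairP[h _] := hq; apply: h. Qed.

Lemma cp_hom_out (p : charpair) x : x \notin cp_grp p -> cp_hom p x = 0.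
Proof. by case: p => q hq; have /is_charpairP[_ h] := hq; apply: h. Qed.

Lemma cp_hom1 (p : charpair) : cp_hom p 1%g = 0.
Proof.
have := @cp_homM p 1%g 1%g (group1 _) (group1 _).
by rewrite mulg1 => /eqP; rewrite -subr_eq0 opprD addNKr oppr_eq0 => /eqP.
Qed.

Lemma cp_homV (p : charpair) x : x \in cp_grp p ->
  cp_hom p x^-1%g = - cp_hom p x.
Proof.
move=> xp; apply/eqP; rewrite -addr_eq0 addrC -cp_homM ?groupV //.
by rewrite mulgV cp_hom1.
Qed.

Lemma charpair_eq (p q : charpair) :
  cp_grp p = cp_grp q :> {set G} ->
  {in cp_grp p, cp_hom p =1 cp_hom q} -> p = q.
Proof.
move=> epq hpq; apply: val_inj.
case: p q epq hpq => [[K phi] hp] [[L psi] hq]; rewrite /cp_grp /cp_hom /=.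
move=> KL h; congr pair; first exact: val_inj.
apply/ffunP=> x; have [xK|xK] := boolP (x \in K); first exact: h.
move/is_charpairP: hp => /= -[_ ->] //.
by move/is_charpairP: hq => /= -[_ ->] //; rewrite -KL.
Qed.

                                                   
Definition conj_val (g : G) (p : charpair) : {group G} * {ffun G -> A} :=
  ((cp_grp p :^ g^-1)%G, [ffun x => cp_hom p (x ^ g)%g]).

Lemma conj_val_subproof g p : is_charpair (conj_val g p).
Proof.
apply/is_charpairP; split=> [x y|x] /=.
  by rewrite !ffunE !mem_conjgV conjMg; apply: cp_homM.
by rewrite ffunE mem_conjgV; apply: cp_hom_out.
Qed.

Definition conj_charpair g p : charpair := CharPair (conj_val_subproof g p).

Definition conj_rel (p q : charpair) : bool :=
  [exists g, q == conj_charpair g p].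

Lemma conj_charpair1 p : conj_charpair 1%g p = p.
Proof.
apply: charpair_eq => [|x _]; rewrite /cp_grp /cp_hom /=.
  by rewrite invg1 conjsg1.
by rewrite ffunE conjg1.
Qed.

Lemma conj_charpairM g h p :
  conj_charpair (g * h)%g p = conj_charpair g (conj_charpair h p).
Proof.
apply: charpair_eq => [|x _]; rewrite /cp_grp /cp_hom /=.
  by rewrite invMg conjsgM.
by rewrite !ffunE conjgM.
Qed.

Lemma conj_rel_refl : reflexive conj_rel.
Proof. by move=> p; apply/existsP; exists 1%g; rewrite conj_charpair1. Qed.

Lemma conj_rel_sym : symmetric conj_rel.
Proof.
suff h p q : conj_rel p q -> conj_rel q p.
  by move=> p q; apply/idP/idP; apply: h.
case/existsP=> g /eqP ->; apply/existsP; exists g^-1%g.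
by rewrite -conj_charpairM mulVg conj_charpair1.
Qed.

Lemma conj_rel_trans : transitive conj_rel.
Proof.
move=> q p r /existsP[g /eqP ->] /existsP[h /eqP ->]; apply/existsP.
by exists (h * g)%g; rewrite conj_charpairM.
Qed.

Canonical conj_equiv :=
  EquivRel conj_rel conj_rel_refl conj_rel_sym conj_rel_trans.

Definition conj_class := {eq_quot conj_equiv}.

HB.instance Definition _ := EqQuotient.on conj_class.
HB.instance Definition _ := Choice.on conj_class.

Lemma conj_class_pi (p q : charpair) :
  (\pi_conj_class p == \pi_conj_class q) = conj_rel p q.
Proof. by rewrite eqmodE. Qed.

End CharPairs.

                                                                                
                                                                                
                                                                                
Definition burnside (A : zmodType) (G : finGroupType) : zmodType :=
  {freeg (conj_class G A) / int}.

Definition basis_class A G (p : charpair G A) : burnside A G :=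
  << \pi_(conj_class G A) p >>.

Section FreeExtension.
Variables (K : choiceType) (M : zmodType) (F : K -> M).

Definition free_ext (D : {freeg K / int}) : M :=
  fglift (F : K -> zmodule M) D.

Lemma free_ext_is_zmod_morphism : zmod_morphism free_ext.
Proof. exact: (@lift_is_additive int K (zmodule M) F). Qed.

HB.instance Definition _ :=
  GRing.isZmodMorphism.Build {freeg K / int} M free_ext
    free_ext_is_zmod_morphism.

Lemma free_extU k : free_ext << k >> = F k.
Proof. by rewrite /free_ext liftU scale1r. Qed.

Lemma free_ext_unique (E : {additive {freeg K / int} -> M}) :
  (forall k, E << k >> = F k) -> E =1 free_ext.
Proof.
move=> EF D; rewrite -[D]freeg_sumE !raddf_sum /=; apply: eq_bigr => k _.
have -> : << coeff k D *g k >> = << k >> *~ coeff k D :> {freeg K / int}.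
  by rewrite freegU_mulz intz.
by rewrite !raddfMz EF /= free_extU.
Qed.

End FreeExtension.

                                                                  
Section Transitive.
Variables (G : finGroupType) (A : zmodType) (p : charpair G A).

Definition coset_rel (x y : G * A) : bool :=
  [exists k in cp_grp p, y == ((x.1 * k)%g, x.2 + cp_hom p k)].

Lemma coset_relP (x y : G * A) :
  reflect (exists2 k, k \in cp_grp p & y = ((x.1 * k)%g, x.2 + cp_hom p k))
          (coset_rel x y).
Proof.
apply: (iffP exists_inP) => -[k kK]; first by move/eqP; exists k.
by move=> ->; exists k.
Qed.

Lemma coset_rel_refl : reflexive coset_rel.
Proof.
by case=> g a; apply/coset_relP; exists 1%g; rewrite ?mulg1 ?cp_hom1 ?addr0.
Qed.

Lemma coset_rel_sym : symmetric coset_rel.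
Proof.
suff h x y : coset_rel x y -> coset_rel y x.
  by move=> x y; apply/idP/idP; apply: h.
case: x => g a /coset_relP[k kK ->] /=; apply/coset_relP.
by exists k^-1%g; rewrite ?groupV //= cp_homV // addrK mulgK.
Qed.

Lemma coset_rel_trans : transitive coset_rel.
Proof.
move=> y x z /coset_relP[k kK ->] /coset_relP[l lK ->]; apply/coset_relP.
by exists (k * l)%g; rewrite ?groupM //= cp_homM // addrA mulgA.
Qed.

Canonical coset_equiv :=
  EquivRel coset_rel coset_rel_refl coset_rel_sym coset_rel_trans.

Definition coset_space := {eq_quot coset_equiv}.

HB.instance Definition _ := EqQuotient.on coset_space.
HB.instance Definition _ := Choice.on coset_space.

Definition coset_act (g : G) (a : A) (x : coset_space) : coset_space :=
  \pi_coset_space ((g * (repr x).1)%g, a + (repr x).2).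

Lemma coset_pi (x y : G * A) :
  (\pi_coset_space x == \pi_coset_space y) = coset_rel x y.
Proof. by rewrite eqmodE. Qed.

Lemma coset_actE g a x :
  coset_act g a (\pi_coset_space x) = \pi_coset_space ((g * x.1)%g, a + x.2).
Proof.
rewrite /coset_act; apply/eqP; rewrite coset_pi.
have : coset_rel (repr (\pi_coset_space x)) x by rewrite -coset_pi reprK.
move: (repr _) => y /coset_relP[k kK ->].
by apply/coset_relP; exists k => //=; rewrite addrA mulgA.
Qed.

Lemma coset_act1 x : coset_act 1%g 0 x = x.
Proof. by rewrite /coset_act mul1g add0r -surjective_pairing reprK. Qed.

Lemma coset_actM g h a b x :
  coset_act (g * h)%g (a + b) x = coset_act g a (coset_act h b x).
Proof.
by elim/quotW: x => x; rewrite (coset_actE h) !coset_actE mulgA addrA.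
Qed.

Definition coset_gaset : gaset G A := GASet coset_act1 coset_actM.

Lemma coset_stab g a x : ga_act g a (\pi_coset_space x : coset_gaset) = \pi_coset_space x ->
  (g ^ x.1)%g \in cp_grp p /\ a = cp_hom p (g ^ x.1)%g.
Proof.
rewrite /= coset_actE => /esym/eqP; rewrite coset_pi => /coset_relP[k kK].
case=> gE aE; have -> : (g ^ x.1)%g = k by rewrite conjgE gE mulKg.
by split=> //; move: aE; rewrite addrC => /addrI.
Qed.

Lemma coset_stabV g x : (g ^ x.1)%g \in cp_grp p ->
  ga_act g (cp_hom p (g ^ x.1)%g) (\pi_coset_space x : coset_gaset) = \pi_coset_space x.
Proof.
move=> gK; rewrite /= coset_actE; apply/eqP; rewrite eq_sym coset_pi.
apply/coset_relP; exists (g ^ x.1)%g => //.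
by rewrite conjgE mulKVg addrC.
Qed.

Lemma coset_free (x : coset_gaset) : trivial_fiber_stabilizer x.
Proof.
elim/quotW: x => x a /coset_stab[_ ->]; by rewrite conj1g cp_hom1.
Qed.

Definition base_coset : coset_gaset := \pi_coset_space (1%g, 0).

Lemma coset_transitive (x : coset_gaset) : orbit_rel base_coset x.
Proof.
elim/quotW: x => x; apply/orbit_relP; exists x.1, x.2.
by rewrite /= coset_actE /= mulg1 addr0 -surjective_pairing.
Qed.

Lemma coset_fin : finitely_many_orbits coset_gaset.
Proof.
apply/finitely_many_orbitsP; exists [:: base_coset] => x.
by exists base_coset; [rewrite inE | exact: coset_transitive].
Qed.

Definition transitive_fibset : fibset G A := FibSet coset_free coset_fin.

End Transitive.

                                                                               
Section StabPair.
Variables (G : finGroupType) (A : zmodType) (X : fibset G A) (x : X).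

Definition stab_fun (g : G) : A := xget 0 [set a | ga_act g a x = x]%classic.

Definition stab_set : {set G} := [set g | `[< exists a, ga_act g a x = x >]].

Lemma ga_act_inj g a b : ga_act g a x = ga_act g b x -> a = b.
Proof.
move=> ab; apply/eqP; rewrite -subr_eq0; apply/eqP/(@fib_free _ _ X x).
by rewrite addrC -(mulVg g) ga_actM ab ga_actK.
Qed.

Lemma mem_stab_set g : (g \in stab_set) = `[< exists a, ga_act g a x = x >].
Proof. by rewrite /stab_set finset.in_set. Qed.

Lemma stab_setP g :
  reflect (ga_act g (stab_fun g) x = x) (g \in stab_set).
Proof.
rewrite mem_stab_set; apply: (iffP (asboolP _)) => [[a ax]|gx]; last by exists (stab_fun g).
by rewrite /stab_fun; case: xgetP => [b -> //|/(_ a)/(_ ax)].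
Qed.

Lemma stab_funE g a : ga_act g a x = x -> stab_fun g = a.
Proof.
move=> gx; apply: (@ga_act_inj g); rewrite gx; apply/stab_setP.
by rewrite mem_stab_set; apply/asboolP; exists a.
Qed.

Lemma stab_group_set : group_set stab_set.
Proof.
apply/group_setP; split=> [|g h].
  by rewrite mem_stab_set; apply/asboolP; exists 0; apply: ga_act1.
move=> /stab_setP gx /stab_setP hx; rewrite mem_stab_set; apply/asboolP.
by exists (stab_fun g + stab_fun h); rewrite ga_actM hx.
Qed.

Definition stab_val : {group G} * {ffun G -> A} :=
  (Group stab_group_set, [ffun g => stab_fun g]).

Lemma stab_val_subproof : is_charpair stab_val.
Proof.
apply/is_charpairP; split=> [g h /stab_setP gx /stab_setP hx|g] /=.
  by rewrite !ffunE; apply: stab_funE; rewrite ga_actM hx.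
rewrite mem_stab_set => /asboolP gx; rewrite ffunE /stab_fun.
by case: xgetP => // a _ ax; case: gx; exists a.
Qed.

Definition stab_pair : charpair G A := CharPair stab_val_subproof.

Lemma stab_pairP g a :
  ga_act g a x = x <-> g \in cp_grp stab_pair /\ a = cp_hom stab_pair g.
Proof.
rewrite /cp_grp /cp_hom /= ffunE; split=> [gx|[/stab_setP gx -> //]].
by rewrite (stab_funE gx) mem_stab_set; split=> //; apply/asboolP; exists a.
Qed.

End StabPair.

                                                                             
Definition fib_class G A (X : fibset G A) : burnside A G :=
  \sum_(o \in [set: orbit_space X]%classic) basis_class (stab_pair (repr o)).

Section DisjointUnion.
Variables (G : finGroupType) (A : zmodType) (X Y : fibset G A).

Definition sum_act g a (z : X + Y) : X + Y :=
  match z with inl x => inl (ga_act g a x) | inr y => inr (ga_act g a y) end.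

Lemma sum_act1 z : sum_act 1%g 0 z = z.
Proof. by case: z => z /=; rewrite ga_act1. Qed.

Lemma sum_actM g h a b z :
  sum_act (g * h)%g (a + b) z = sum_act g a (sum_act h b z).
Proof. by case: z => z /=; rewrite ga_actM. Qed.

Definition sum_gaset : gaset G A := GASet sum_act1 sum_actM.

Lemma sum_free (z : sum_gaset) : trivial_fiber_stabilizer z.
Proof. by case: z => z a /= [] /fib_free. Qed.

Lemma orbit_rel_inl (x y : X) :
  orbit_rel (inl x : sum_gaset) (inl y : sum_gaset) = orbit_rel x y.
Proof.
apply/orbit_relP/orbit_relP => -[g [a]] /= => [[->]|->]; by exists g, a.
Qed.

Lemma orbit_rel_inr (x y : Y) :
  orbit_rel (inr x : sum_gaset) (inr y : sum_gaset) = orbit_rel x y.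
Proof.
apply/orbit_relP/orbit_relP => -[g [a]] /= => [[->]|->]; by exists g, a.
Qed.

Lemma orbit_rel_inlr (x : X) (y : Y) :
  orbit_rel (inl x : sum_gaset) (inr y : sum_gaset) = false.
Proof. by apply/negP => /orbit_relP[g [a]]. Qed.

Lemma sum_fin : finitely_many_orbits sum_gaset.
Proof.
have /finitely_many_orbitsP[s sP] := @fib_fin _ _ X.
have /finitely_many_orbitsP[t tP] := @fib_fin _ _ Y.
apply/finitely_many_orbitsP; exists (map inl s ++ map inr t) => -[x|y].
  have [z zs zx] := sP x; exists (inl z); rewrite ?orbit_rel_inl //.
  by rewrite mem_cat map_f.
have [z zt zy] := tP y; exists (inr z); rewrite ?orbit_rel_inr //.
by rewrite mem_cat map_f ?orbT.
Qed.

Definition fib_sum : fibset G A := FibSet sum_free sum_fin.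

End DisjointUnion.

Section ClassTheory.
Variables (G : finGroupType) (A : zmodType).
Implicit Types (X Y : fibset G A).

Lemma stab_pair_act X (x : X) g a :
  stab_pair (ga_act g a x) = conj_charpair g (stab_pair x).
Proof.
have key h b : ga_act h b (ga_act g a x) = ga_act g a x <->
    ga_act (h ^ g)%g b x = x.
  split=> hx; last first.
    rewrite -[in RHS]hx -!ga_actM conjgE mulKVg; congr ga_act.
    by rewrite addrC.
  apply: (can_inj (@ga_actK G A X g a)); rewrite -[RHS]hx -!ga_actM.
  by rewrite conjgE mulKVg addrC.
have grpE h : (h \in cp_grp (stab_pair (ga_act g a x))) =
    ((h ^ g)%g \in cp_grp (stab_pair x)).
  apply/idP/idP => hx.
    have /key/stab_pairP[] // : ga_act h (cp_hom (stab_pair (ga_act g a x)) h)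
      (ga_act g a x) = ga_act g a x by apply/stab_pairP.
  have /key/stab_pairP[] // : ga_act (h ^ g)%g (cp_hom (stab_pair x) (h ^ g)%g)
      x = x by apply/stab_pairP.
apply: charpair_eq => [|h hx].
  by apply/setP=> h; rewrite grpE [in RHS]/cp_grp /= mem_conjgV.
rewrite [RHS]ffunE; have := hx; rewrite grpE => hx'.
have /key/stab_pairP[] // : ga_act h (cp_hom (stab_pair (ga_act g a x)) h)
      (ga_act g a x) = ga_act g a x by apply/stab_pairP.
Qed.

Lemma basis_class_conj g (p : charpair G A) :
  basis_class (conj_charpair g p) = basis_class p.
Proof.
congr (<< _ >>); apply/eqP; rewrite eq_sym conj_class_pi.
by apply/existsP; exists g.
Qed.

Lemma basis_stab_orbit X (x y : X) : orbit_rel x y ->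
  basis_class (stab_pair x) = basis_class (stab_pair y).
Proof.
by case/orbit_relP=> g [a ->]; rewrite stab_pair_act basis_class_conj.
Qed.

Definition transversal X (s : seq X) :=
  uniq [seq \pi_(orbit_space X) x | x <- s] /\
  forall x, exists2 y, y \in s & orbit_rel y x.

Lemma ex_transversal X : exists s : seq X, transversal s.
Proof.
have /finitely_many_orbitsP[s sP] := @fib_fin _ _ X.
exists [seq repr o | o <- undup [seq \pi_(orbit_space X) x | x <- s]].
split.
  rewrite -map_comp (@eq_map _ _ _ id) ?map_id ?undup_uniq // => o /=.
  exact: reprK.
move=> x; have [y ys yx] := sP x; exists (repr (\pi_(orbit_space X) y)).
  by apply: map_f; rewrite mem_undup map_f.
by apply: orbit_rel_trans yx; rewrite -orbit_pi reprK.
Qed.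

Lemma fib_classE X (s : seq X) : transversal s ->
  fib_class X = \sum_(x <- s) basis_class (stab_pair x).
Proof.
case=> us sP; rewrite /fib_class.
have -> : [set: orbit_space X]%classic =
    [set` [seq \pi_(orbit_space X) x | x <- s]]%classic.
  apply/seteqP; split=> // o _ /=; have [y ys yo] := sP (repr o).
  apply/mapP; exists y => //.
  by apply/eqP; rewrite eq_sym -[o]reprK orbit_pi.
rewrite -fsbig_seq // big_map; apply: eq_bigr => x _.
by apply: basis_stab_orbit; rewrite -orbit_pi reprK.
Qed.

Lemma stab_pair_inj X Y (F : X -> Y) : injective F ->
  (forall g a x, F (ga_act g a x) = ga_act g a (F x)) ->
  forall x, stab_pair (F x) = stab_pair x.
Proof.
move=> injF FE x.
have key g a : ga_act g a (F x) = F x <-> ga_act g a x = x.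
  by split=> [|gx]; rewrite -FE ?gx // => /injF.
have grpE g : (g \in cp_grp (stab_pair (F x))) = (g \in cp_grp (stab_pair x)).
  apply/idP/idP => gx.
    have /key/stab_pairP[] // : ga_act g (cp_hom (stab_pair (F x)) g) (F x)
      = F x by apply/stab_pairP.
  have /key/stab_pairP[] // : ga_act g (cp_hom (stab_pair x) g) x = x.
  by apply/stab_pairP.
apply: charpair_eq => [|g gx]; first by apply/setP=> g; rewrite grpE.
by have /key/stab_pairP[] // : ga_act g (cp_hom (stab_pair (F x)) g) (F x)
      = F x by apply/stab_pairP.
Qed.

Lemma fib_class_iso X Y : gaset_iso X Y -> fib_class X = fib_class Y.
Proof.
case=> F bF FE; have [s ts] := ex_transversal X.
have [F' FK F'K] := bF.
have oE x y : orbit_rel (F x) (F y) = orbit_rel x y.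
  apply/orbit_relP/orbit_relP => -[g [a]]; rewrite -?FE => h; exists g, a.
    exact: (can_inj FK).
  by rewrite h FE.
have tFs : transversal (map F s).
  case: ts => us sP; split.
    rewrite -map_comp; elim: s us {sP} => //= x s IHs /andP[xs /IHs ->].
    rewrite andbT; apply: contra xs => /mapP[y ys /eqP].
    rewrite /= orbit_pi oE -orbit_pi => /eqP ->.
    exact: (map_f (\pi_(orbit_space X))).
  move=> y; have [x xs xy] := sP (F' y); exists (F x); first exact: map_f.
  by rewrite -[y]F'K oE.
rewrite (fib_classE ts) (fib_classE tFs) big_map; apply: eq_bigr => x _.
by rewrite (stab_pair_inj (bij_inj bF) FE).
Qed.

Lemma fib_class_sum X Y :
  fib_class (fib_sum X Y) = fib_class X + fib_class Y.
Proof.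
have [s ts] := ex_transversal X; have [t tt] := ex_transversal Y.
have stl (x : X) : stab_pair (inl x : fib_sum X Y) = stab_pair x.
  by apply: (@stab_pair_inj X (fib_sum X Y) inl) => // ? ? [].
have str (y : Y) : stab_pair (inr y : fib_sum X Y) = stab_pair y.
  by apply: (@stab_pair_inj Y (fib_sum X Y) inr) => // ? ? [].
have tst : transversal
    ([seq inl x | x <- s] ++ [seq inr y | y <- t] : seq (fib_sum X Y)).
  case: ts tt => us sP [ut tP]; split.
    rewrite map_cat cat_uniq -!map_comp; apply/and3P; split.
    - elim: s us {sP} => //= x s IHs /andP[xs /IHs ->].
      rewrite andbT; apply: contra xs => /mapP[y ys /eqP].
      rewrite /= orbit_pi orbit_rel_inl -orbit_pi => /eqP ->.
      exact: (map_f (\pi_(orbit_space X))).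
    - apply/hasPn => _ /mapP[y yt ->]; apply/mapP => -[x xs /esym/eqP].
      by rewrite /= orbit_pi orbit_rel_inlr.
    - elim: t ut {tP} => //= x t IHt /andP[xt /IHt ->].
      rewrite andbT; apply: contra xt => /mapP[y yt /eqP].
      rewrite /= orbit_pi orbit_rel_inr -orbit_pi => /eqP ->.
      exact: (map_f (\pi_(orbit_space Y))).
  move=> [x|y].
    have [z zs zx] := sP x; exists (inl z); rewrite ?orbit_rel_inl //.
    by rewrite mem_cat map_f.
  have [z zt zy] := tP y; exists (inr z); rewrite ?orbit_rel_inr //.
  by rewrite mem_cat map_f ?orbT.
rewrite (fib_classE ts) (fib_classE tt) (fib_classE tst) big_cat !big_map.
by congr (_ + _); apply: eq_bigr => x _; rewrite ?stl ?str.
Qed.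

Lemma stab_pair_base (p : charpair G A) :
  @stab_pair G A (transitive_fibset p) (base_coset p) = p.
Proof.
pose x0 : transitive_fibset p := base_coset p; rewrite -/x0.
have bE g a : ga_act g a x0 = x0 <-> g \in cp_grp p /\ a = cp_hom p g.
  split=> [/coset_stab|[gp ->]]; first by rewrite conjg1.
  by have := @coset_stabV G A p g (1%g, 0); rewrite conjg1; apply.
have sE g : g \in cp_grp (stab_pair x0) -> ga_act g (cp_hom (stab_pair x0) g) x0 = x0.
  by move=> gx; apply/stab_pairP.
apply: charpair_eq => [|g gx]; last by have /bE[] := sE g gx.
apply/setP=> g; apply/idP/idP => [/sE/bE[]//|gp].
by have /stab_pairP[] : ga_act g (cp_hom p g) x0 = x0 by apply/bE.
Qed.

Lemma fib_class_transitive (p : charpair G A) : fib_class (transitive_fibset p) = basis_class p.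
Proof.
have t : @transversal (transitive_fibset p) [:: base_coset p].
  split=> // x; exists (base_coset p); last exact: coset_transitive.
  by rewrite inE.
by rewrite (fib_classE t) big_seq1 stab_pair_base.
Qed.

End ClassTheory.

Section UniversalProperty.
Variables (G : finGroupType) (A : zmodType).
Implicit Types (X Y : fibset G A).

Lemma transitive_iso X (x : X) : (forall y, orbit_rel x y) ->
  gaset_iso (transitive_fibset (stab_pair x)) X.
Proof.
move=> xT; set p := stab_pair x.
pose F (c : transitive_fibset p) := ga_act (repr c).1 (repr c).2 x.
have FE z : F (\pi_(coset_space p) z) = ga_act z.1 z.2 x.
  rewrite /F.
  have : coset_rel p (repr (\pi_(coset_space p) z)) z.
    by rewrite -coset_pi reprK.
  move: (repr _) => y /coset_relP[k kK ->] /=; rewrite ga_actM.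
  by congr ga_act; apply/esym/stab_pairP.
exists F; last first.
  move=> g a; elim/quotW => z.
  by rewrite [ga_act g a _]coset_actE !FE -ga_actM.
have injF : injective F.
  elim/quotW=> z; elim/quotW=> w; rewrite !FE => zw.
  apply/eqP; rewrite coset_pi; apply/coset_relP.
  have /stab_pairP[kK kE] : ga_act (z.1^-1 * w.1)%g (- z.2 + w.2) x = x.
    by rewrite ga_actM -zw ga_actK.
  exists (z.1^-1 * w.1)%g => //.
  by rewrite mulKVg -kE addNKr -surjective_pairing.
have surF y : exists c, F c = y.
  have /orbit_relP[g [a ->]] := xT y.
  by exists (\pi_(coset_space p) (g, a)); rewrite FE.
have [F' F'K] := boolp.choice surF.
by exists F' => // c; apply: injF; rewrite F'K.
Qed.

Lemma gaset_iso_sym (X Y : gaset G A) : gaset_iso X Y -> gaset_iso Y X.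
Proof.
move=> [F [F' FK F'K] FE]; exists F'; first by exists F.
by move=> g a y; apply: (can_inj FK); rewrite FE !F'K.
Qed.

Definition sub_fibset X (P : pred X)
    (P_act : forall g a x, P x -> P (ga_act g a x)) : fibset G A :=
  @FibSet G A (sub_gaset P_act)
    (fun z a za => fib_free (congr1 val za)) (sub_fin P_act (@fib_fin G A X)).

Section Extension.
Variables (M : zmodType) (F : fibset G A -> M).
Hypothesis F_iso : forall X Y, gaset_iso X Y -> F X = F Y.
Hypothesis F_sum : forall X Y, F (fib_sum X Y) = F X + F Y.

Lemma additive_transversal X (s : seq X) : transversal s ->
  F X = \sum_(x <- s) F (transitive_fibset (stab_pair x)).
Proof.
have [n le_sn] := ubnP (size s); elim: n X s le_sn => // n IHn X [|x s] /= le_sn.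
  move=> [_ sP]; have X0 (x : X) : False by have [] := sP x.
  rewrite big_nil; apply: (@addrI _ (F X)); rewrite addr0 -F_sum.
  apply/esym/F_iso; exists inl; last by move=> ? ? x; case: (X0 x).
  by exists (fun z => match z with inl x => x | inr x => x end) => [x|[x|x]];
    case: (X0 x).
move=> [/= /andP[xs us] sP].
pose P := orbit_rel x.
have P_act g a y : P y -> P (ga_act g a y).
  by move/orbit_rel_trans; apply; apply/orbit_relP; exists g, a.
have P'_act g a y : predC P y -> predC P (ga_act g a y).
  apply: contra => /orbit_rel_trans; apply; rewrite orbit_rel_sym.
  by apply/orbit_relP; exists g, a.
pose Y := sub_fibset P_act; pose Z := sub_fibset P'_act.
have -> : F X = F Y + F Z.
  rewrite -F_sum; apply/esym/F_iso.
  exists (fun z : fib_sum Y Z => match z with inl y => val y | inr y => val y end).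
    have surj (y : X) : exists z : fib_sum Y Z,
        match z with inl y' => val y' | inr y' => val y' end = y.
      have [Py|Py] := boolP (P y); first by exists (inl (exist _ y Py)).
      by exists (inr (exist _ y Py)).
    have [h hK] := boolp.choice surj.
    exists h => // -[] z; case: (h _) (hK (val z)) => y.
    - by move/val_inj->.
    - by move=> yz; have := valP y; rewrite /= yz (valP z).
    - by move=> yz; have := valP z; rewrite /= -yz (valP y).
    - by move/val_inj->.
  by move=> g a [].
rewrite big_cons; congr (_ + _).
  pose x' : Y := exist _ x (orbit_rel_refl x).
  have -> : stab_pair x = stab_pair x'.
    exact: (@stab_pair_inj G A Y X val val_inj (fun _ _ _ => erefl) x').
  apply/esym/F_iso/transitive_iso => y.
  by rewrite orbit_rel_sub; apply: (valP y).
have sN : all (predC P) s.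
  apply/allP => y ys; apply: contra xs => xy.
  apply/mapP; exists y => //; apply/eqP; by rewrite orbit_pi.
pose t : seq Z := pmap insub s.
have tE : s = map val t.
  rewrite pmap_filter; last exact: insubK.
  apply/esym/all_filterP/allP => y /(allP sN) yP /=.
  by rewrite insubT.
rewrite tE big_map (IHn Z t); first 1 last.
- by rewrite -(size_map val) -tE.
- split.
    move: us; rewrite {1}tE -map_comp; elim: (t) => //= y r IHr /andP[yr /IHr ->].
    rewrite andbT; apply: contra yr => /mapP[z zr /eqP].
    rewrite orbit_pi orbit_rel_sub -orbit_pi => /eqP ->.
    exact: (map_f (fun z : Z => \pi_(orbit_space X) (val z))).
  move=> z; have [y] := sP (val z); rewrite inE => /predU1P[->|ys] yz.
    by have := valP z; rewrite /= /P yz.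
  move: ys; rewrite tE => /mapP[y' y't yE].
  by exists y' => //; rewrite orbit_rel_sub -yE.
apply: eq_bigr => z _; congr (F (transitive_fibset _)).
exact/esym/(@stab_pair_inj G A Z X val val_inj (fun _ _ _ => erefl) z).
Qed.

Definition burnside_ext : burnside A G -> M :=
  free_ext (fun o : conj_class G A => F (transitive_fibset (repr o))).

HB.instance Definition _ := GRing.Additive.on burnside_ext.

Lemma transitive_conj (p q : charpair G A) : conj_rel p q ->
  F (transitive_fibset p) = F (transitive_fibset q).
Proof.
case/existsP=> g /eqP ->; apply/esym/F_iso.
have := @transitive_iso (transitive_fibset p) (ga_act g 0 (base_coset p)).
rewrite stab_pair_act stab_pair_base; apply => y.
apply: orbit_rel_trans (coset_transitive y); rewrite orbit_rel_sym.
by apply/orbit_relP; exists g, 0.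
Qed.

Lemma burnside_extE X : burnside_ext (fib_class X) = F X.
Proof.
have [s ts] := ex_transversal X.
rewrite (fib_classE ts) (additive_transversal ts) raddf_sum /=.
apply: eq_bigr => x _; rewrite /burnside_ext free_extU.
by apply: transitive_conj; rewrite -conj_class_pi reprK.
Qed.

End Extension.

Lemma burnside_additive_eq (M : zmodType)
    (E E' : {additive burnside A G -> M}) :
  (forall X, E (fib_class X) = E' (fib_class X)) -> E =1 E'.
Proof.
move=> EE' D.
have h (k : conj_class G A) : E << k >> = E' << k >>.
  have := EE' (transitive_fibset (repr k)).
  by rewrite fib_class_transitive /basis_class reprK.
rewrite (free_ext_unique h).
by rewrite (@free_ext_unique _ _ (fun k => E' << k >>) E').
Qed.

                                                                                
                                                                                
                                                                                
Theorem burnside_universal (M : zmodType) (F : fibset G A -> M) :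
  (forall X Y, gaset_iso X Y -> F X = F Y) ->
  (forall X Y, F (fib_sum X Y) = F X + F Y) ->
  exists E : {additive burnside A G -> M},
    (forall X, E (fib_class X) = F X) /\
    (forall E' : {additive burnside A G -> M},
       (forall X, E' (fib_class X) = F X) -> E' =1 E).
Proof.
move=> F_iso F_sum; exists (burnside_ext F : {additive _ -> _}).
have EF X : burnside_ext F (fib_class X) = F X by exact: burnside_extE.
split=> // E' E'F; apply: burnside_additive_eq => X.
by rewrite E'F -EF.
Qed.

End UniversalProperty.

Record biset (H G : finGroupType) := Biset {
  bs_car :> finType;
  bs_lact : H -> bs_car -> bs_car;
  bs_ract : bs_car -> G -> bs_car;
  bs_lact1 : forall u, bs_lact 1%g u = u;
  bs_lactM : forall h k u, bs_lact (h * k)%g u = bs_lact h (bs_lact k u);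
  bs_ract1 : forall u, bs_ract u 1%g = u;
  bs_ractM : forall u g l, bs_ract u (g * l)%g = bs_ract (bs_ract u g) l;
  bs_lractA : forall h u g, bs_ract (bs_lact h u) g = bs_lact h (bs_ract u g) }.

Section BalancedProduct.
Variables (H G : finGroupType) (A : zmodType).
Variables (U : biset H G) (X : gaset G A).

                         
Definition balanced_rel (p q : U * X) : bool :=
  `[< exists g, p.1 = bs_ract q.1 g /\ q.2 = ga_act g 0 p.2 >].

Lemma balanced_relP (p q : U * X) :
  reflect (exists g, p.1 = bs_ract q.1 g /\ q.2 = ga_act g 0 p.2)
          (balanced_rel p q).
Proof. exact: asboolP. Qed.

Lemma balanced_rel_refl : reflexive balanced_rel.
Proof. by move=> p; apply/balanced_relP; exists 1%g; rewrite bs_ract1 ga_act1. Qed.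

Lemma balanced_rel_sym : symmetric balanced_rel.
Proof.
suff h p q : balanced_rel p q -> balanced_rel q p.
  by move=> p q; apply/idP/idP; apply: h.
case: p q => u x [v y] /balanced_relP[g /= [-> ->]]; apply/balanced_relP.
exists g^-1%g; rewrite /= -bs_ractM mulgV bs_ract1; split=> //.
by rewrite -ga_actM mulVg addr0 ga_act1.
Qed.

Lemma balanced_rel_trans : transitive balanced_rel.
Proof.
move=> [v y] [u x] [w z] /balanced_relP[g /= [-> ->]].
move=> /balanced_relP[l /= [-> ->]]; apply/balanced_relP; exists (l * g)%g.
by rewrite /= bs_ractM -ga_actM addr0.
Qed.

Canonical balanced_equiv :=
  EquivRel balanced_rel balanced_rel_refl balanced_rel_sym balanced_rel_trans.

Definition balanced_space := {eq_quot balanced_equiv}.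

HB.instance Definition _ := EqQuotient.on balanced_space.
HB.instance Definition _ := Choice.on balanced_space.

Lemma balanced_pi (p q : U * X) :
  (\pi_balanced_space p == \pi_balanced_space q) = balanced_rel p q.
Proof. by rewrite eqmodE. Qed.

Definition balanced_act (h : H) (a : A) (q : balanced_space) : balanced_space :=
  \pi_balanced_space (bs_lact h (repr q).1, ga_act 1%g a (repr q).2).

Lemma balanced_actE h a p :
  balanced_act h a (\pi_balanced_space p) =
  \pi_balanced_space (bs_lact h p.1, ga_act 1%g a p.2).
Proof.
rewrite /balanced_act; apply/eqP; rewrite balanced_pi.
have : balanced_rel (repr (\pi_balanced_space p)) p.
  by rewrite -balanced_pi reprK.
move: (repr _) => -[u x]; case: p => v y /balanced_relP[g /= [-> ->]].
apply/balanced_relP; exists g; rewrite /= bs_lractA; split=> //.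
by rewrite -!ga_actM mul1g mulg1 addr0 add0r.
Qed.

Lemma balanced_act1 q : balanced_act 1%g 0 q = q.
Proof.
by rewrite /balanced_act bs_lact1 ga_act1 -surjective_pairing reprK.
Qed.

Lemma balanced_actM h k a b q :
  balanced_act (h * k)%g (a + b) q = balanced_act h a (balanced_act k b q).
Proof.
elim/quotW: q => p; rewrite (balanced_actE k) !balanced_actE bs_lactM /=.
by rewrite -ga_actM mulg1.
Qed.

             
Definition balanced_product : gaset H A := GASet balanced_act1 balanced_actM.

Definition tensor_pred (q : balanced_product) : bool :=
  `[< trivial_fiber_stabilizer q >].

Lemma tensor_pred_act h a q : tensor_pred q -> tensor_pred (ga_act h a q).
Proof.
move=> /asboolP q1; apply/asboolP => b; rewrite -ga_actM => hq; apply: q1.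
apply: (can_inj (@ga_actK _ _ _ h a)).
by rewrite -[RHS]hq -ga_actM mulg1 mul1g addrC.
Qed.

               
Definition tensor_gaset : gaset H A := sub_gaset tensor_pred_act.

Lemma tensor_free (z : tensor_gaset) : trivial_fiber_stabilizer z.
Proof.
move=> a /(congr1 val) /= za; have /asboolP qP : tensor_pred (val z) := valP z.
exact: qP.
Qed.

Lemma tensor_fin : finitely_many_orbits X -> finitely_many_orbits tensor_gaset.
Proof.
move=> /finitely_many_orbitsP[s sP]; apply/sub_fin/finitely_many_orbitsP.
exists [seq \pi_balanced_space (u, x) | u <- enum U, x <- s].
elim/quotW=> -[u x].
have [y ys /orbit_relP[g [a ->]]] := sP x.
exists (\pi_balanced_space (bs_ract u g, y)).
  by apply/allpairsP; exists (bs_ract u g, y); rewrite mem_enum.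
apply/orbit_relP; exists 1%g, a; rewrite [RHS]balanced_actE bs_lact1 /=.
apply/eqP; rewrite eq_sym balanced_pi; apply/balanced_relP; exists g => /=.
by rewrite -ga_actM mulg1 add0r.
Qed.

End BalancedProduct.

Definition tensor H G A (U : biset H G) (X : fibset G A) : fibset H A :=
  FibSet (@tensor_free H G A U X) (tensor_fin U (@fib_fin G A X)).

Section TensorMap.
Variables (H G : finGroupType) (A : zmodType) (U : biset H G).
Variables (X Y : fibset G A) (F : X -> Y).
Hypothesis injF : injective F.
Hypothesis FE : forall g a x, F (ga_act g a x) = ga_act g a (F x).

Definition balanced_map (q : balanced_product U X) : balanced_product U Y :=
  \pi_(balanced_space U Y) ((repr q).1, F (repr q).2).

Lemma balanced_mapE p : balanced_map (\pi_(balanced_space U X) p) =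
  \pi_(balanced_space U Y) (p.1, F p.2).
Proof.
rewrite /balanced_map; apply/eqP; rewrite balanced_pi.
have : balanced_rel (repr (\pi_(balanced_space U X) p)) p.
  by rewrite -balanced_pi reprK.
move: (repr _) => -[u x]; case: p => v y /balanced_relP[g /= [-> ->]].
by apply/balanced_relP; exists g; rewrite /= FE.
Qed.

Lemma balanced_map_act h a q :
  balanced_map (ga_act h a q) = ga_act h a (balanced_map q).
Proof.
elim/quotW: q => p.
by rewrite /= balanced_actE !balanced_mapE balanced_actE /= FE.
Qed.

Lemma balanced_map_inj : injective balanced_map.
Proof.
elim/quotW=> p; elim/quotW=> q; rewrite !balanced_mapE => /eqP.
rewrite balanced_pi => /balanced_relP[g /= [pq]]; rewrite -FE => /injF qp.
by apply/eqP; rewrite balanced_pi; apply/balanced_relP; exists g.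
Qed.

Lemma tensor_pred_map q : tensor_pred (balanced_map q) = tensor_pred q.
Proof.
apply/asboolP/asboolP => hq a aq; apply: hq.
  by rewrite -balanced_map_act aq.
by apply: balanced_map_inj; rewrite balanced_map_act.
Qed.

Lemma tensor_map_subproof (z : tensor U X) : tensor_pred (balanced_map (val z)).
Proof. by rewrite tensor_pred_map; apply: valP. Qed.

Definition tensor_map (z : tensor U X) : tensor U Y :=
  exist _ (balanced_map (val z)) (tensor_map_subproof z).

Lemma tensor_map_inj : injective tensor_map.
Proof. by move=> z w [] /balanced_map_inj; apply: val_inj. Qed.

Lemma tensor_map_act h a z :
  tensor_map (ga_act h a z) = ga_act h a (tensor_map z).
Proof. by apply: val_inj; apply: balanced_map_act. Qed.

Lemma tensor_map_img (w : tensor U Y) u x :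
  val w = \pi_(balanced_space U Y) (u, F x) -> exists z, tensor_map z = w.
Proof.
rewrite -(balanced_mapE (u, x)) => wE.
have := valP w; rewrite /= wE tensor_pred_map => zP.
by exists (exist (fun q => tensor_pred q) _ zP); apply: val_inj.
Qed.

End TensorMap.

Section TensorTheory.
Variables (H G : finGroupType) (A : zmodType) (U : biset H G).
Implicit Types (X Y : fibset G A).

Lemma inj_surj_bij (S T : Type) (F : S -> T) :
  injective F -> (forall y, exists x, F x = y) -> bijective F.
Proof.
move=> injF surF; have [F' F'K] := boolp.choice surF.
by exists F' => // x; apply: injF; rewrite F'K.
Qed.

Lemma tensor_iso X Y : gaset_iso X Y -> gaset_iso (tensor U X) (tensor U Y).
Proof.
move=> [F bF FE]; exists (tensor_map (U := U) (bij_inj bF) FE); last first.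
  exact: tensor_map_act.
apply: inj_surj_bij => [|w]; first exact: tensor_map_inj.
have [F' _ F'K] := bF; case E : (repr (val w)) => [u y].
apply: (@tensor_map_img _ _ _ _ _ _ _ _ _ _ u (F' y)).
by rewrite F'K -E reprK.
Qed.

Lemma tensor_sum X Y :
  gaset_iso (tensor U (fib_sum X Y)) (fib_sum (tensor U X) (tensor U Y)).
Proof.
have injl : injective (inl : X -> fib_sum X Y) by move=> ? ? [].
have injr : injective (inr : Y -> fib_sum X Y) by move=> ? ? [].
pose Fl := tensor_map (U := U) injl (fun _ _ _ => erefl).
pose Fr := tensor_map (U := U) injr (fun _ _ _ => erefl).
apply: gaset_iso_sym.
exists (fun z : fib_sum (tensor U X) (tensor U Y) =>
          match z with inl z => Fl z | inr z => Fr z end); last first.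
  by move=> h a [z|z]; apply: tensor_map_act.
have NE (z : tensor U X) (w : tensor U Y) : Fl z = Fr w -> False.
  move=> /(congr1 val) /= /eqP; rewrite balanced_pi.
  by case/balanced_relP=> g [].
apply: inj_surj_bij => [[z|z] [w|w]|w].
- by move/tensor_map_inj->.
- by move/NE.
- by move/esym/NE.
- by move/tensor_map_inj->.
case E : (repr (val w)) => [u [x|y]].
  have [|z zE] := @tensor_map_img _ _ _ U _ _ _ injl (fun _ _ _ => erefl) w u x.
    by rewrite -E reprK.
  by exists (inl z).
have [|z zE] := @tensor_map_img _ _ _ U _ _ _ injr (fun _ _ _ => erefl) w u y.
  by rewrite -E reprK.
by exists (inr z).
Qed.

End TensorTheory.

                                                                                
                                                                                
Definition burnside_biset A H G (U : biset H G) :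
    burnside A G -> burnside A H :=
  burnside_ext (fun X : fibset G A => fib_class (tensor U X)).

HB.instance Definition _ A H G (U : biset H G) :=
  GRing.Additive.copy (@burnside_biset A H G U)
    (burnside_ext (fun X : fibset G A => fib_class (tensor U X))).

Lemma burnside_bisetE A H G (U : biset H G) (X : fibset G A) :
  burnside_biset U (fib_class X) = fib_class (tensor U X).
Proof.
rewrite /burnside_biset burnside_extE // => [{}X Y XY|{}X Y].
  exact/fib_class_iso/tensor_iso.
by rewrite -fib_class_sum; apply/fib_class_iso/tensor_sum.
Qed.

Section FiberChange.
Variables (A C : zmodType) (f : {additive A -> C}) (G : finGroupType).

Definition push_val (p : charpair G A) : {group G} * {ffun G -> C} :=
  (cp_grp p, [ffun x => f (cp_hom p x)]).

Lemma push_val_subproof p : is_charpair (push_val p).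
Proof.
apply/is_charpairP; split=> [x y xp yp|x xp] /=; rewrite !ffunE.
  by rewrite cp_homM // raddfD.
by rewrite cp_hom_out // raddf0.
Qed.

                   
Definition push_charpair p : charpair G C := CharPair (push_val_subproof p).

Definition fiber_change : burnside A G -> burnside C G :=
  free_ext (fun o : conj_class G A => basis_class (push_charpair (repr o))).

HB.instance Definition _ :=
  GRing.Additive.copy fiber_change
    (free_ext (fun o : conj_class G A => basis_class (push_charpair (repr o)))).

Lemma push_charpair_conj g p :
  push_charpair (conj_charpair g p) = conj_charpair g (push_charpair p).
Proof.
apply: charpair_eq => [|x _]; first by rewrite /cp_grp.
by rewrite /cp_hom /= !ffunE.
Qed.

Lemma fiber_changeE p :
  fiber_change (basis_class p) = basis_class (push_charpair p).
Proof.
rewrite /fiber_change free_extU.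
have : conj_rel p (repr (\pi_(conj_class G A) p)).
  by rewrite -conj_class_pi reprK.
by case/existsP=> g /eqP ->; rewrite push_charpair_conj basis_class_conj.
Qed.

End FiberChange.

Definition biset_functor_morphism (A C : zmodType)
    (eta : forall G : finGroupType, {additive burnside A G -> burnside C G}) :=
  forall (G H : finGroupType) (U : biset H G) (x : burnside A G),
    eta H (burnside_biset U x) = burnside_biset U (eta G x).

Definition torsion (A : zmodType) (a : A) : Prop :=
  exists2 n : nat, (0 < n)%N & a *+ n = 0.

(* Main.v *)
Require Import Defs.
From mathcomp Require Import all_boot all_algebra all_fingroup.
From mathcomp Require Import boolp generic_quotient freeg.

(** The tensor product U (x)_G X keeps the points of U x_G X that have trivial
    stabilizer in the fiber group, and only this truncation can prevent the
    fiber change from commuting with U.  The stabilizer in A of the class of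
    (u, x) is computed in [tensor_predP]: if (K, phi) is the stabilizing pair
    of x, it is phi (K_u), where K_u is the stabilizer of u in K.  Passing
    from A to C along f turns it into f (phi (K_u)).  As K is finite, phi
    takes torsion values.

    If f is injective on the torsion of A, then phi (K_u) and f (phi (K_u))
    vanish together, so the same points are kept on both sides.  To turn this
    into an identity of classes, f_* [X] = [Y] is derived from any
    f-equivariant map X -> Y that induces a bijection X/A -> Y/C
    ([fiber_change_fib_class]).  For transitive X such a map is
    (g, a) K |-> (g, f a) K, and tensoring with U preserves these maps
    ([tensor_push_fiberwise]).

    Conversely, if f a = f b for torsion elements, then t = a - b is a torsion
    element killed by f.  Let G be cyclic of order n with n t = 0, let
    phi i = i t, and let U be a point.  The tensor product with the transitive
    set of (G, phi) is empty exactly when phi = 0, that is, when t = 0; after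
    fiber change, phi becomes 0 and the tensor product is nonempty.  Since
    only the empty set has class 0, naturality forces t = 0. *)

Set Implicit Arguments.
Unset Strict Implicit.
Unset Printing Implicit Defensive.

Import GRing.Theory.

Local Open Scope ring_scope.
Local Open Scope quotient_scope.

(** * Classes in the fibered Burnside group *)

Section BurnsideGroup.
Variables (A : zmodType) (G : finGroupType).

Lemma additive_eq_basis (M : zmodType) (E E' : {additive burnside A G -> M}) :
  (forall p, E (basis_class p) = E' (basis_class p)) -> E =1 E'.
Proof.
move=> EE'; apply: burnside_additive_eq => X.
have [s ts] := ex_transversal X.
by rewrite (fib_classE ts) !raddf_sum; apply: eq_bigr => x _.
Qed.

(** The additive map sending every basis element to 1 counts the orbits, so a
    class can vanish only when there are none. *)
Lemma fib_class_eq0P (X : fibset G A) : fib_class X = 0 <-> (X -> False).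
Proof.
have [s ts] := ex_transversal X; have [_ sP] := ts.
rewrite (fib_classE ts); split=> [s0 x|X0]; last first.
  by rewrite big1_seq // => x; case: (X0 x).
have /(congr1 (free_ext (fun=> 1 : int))) := s0.
rewrite raddf_sum raddf0.
under eq_bigr => y _ do rewrite /basis_class /= free_extU.
case: s {ts s0} sP => [|y s] sP; first by have [] := sP x.
rewrite big_const_seq count_predT iter_addr_0 => /eqP.
by rewrite Num.Theory.pnatr_eq0.
Qed.

End BurnsideGroup.

(** * Equivariant maps over a change of fiber *)

Section FiberwiseBijection.
Variables (A C : zmodType) (f : {additive A -> C}).

(** For an f-equivariant map, the last two clauses say that the induced map
    X/A -> Y/C is injective and surjective.  When A and C act freely, Y is then
    the extension of scalars of X along f. *)
Definition fiberwise_bijective G (X : gaset G A) (Y : gaset G C) (F : X -> Y) :=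
  [/\ forall g a x, F (ga_act g a x) = ga_act g (f a) (F x),
      forall x y c, F y = ga_act 1%g c (F x) -> exists a, y = ga_act 1%g a x
    & forall y, exists x c, y = ga_act 1%g c (F x)].

Section OneGroup.
Variable G : finGroupType.

Section Stabilizers.
Variables (X : fibset G A) (Y : fibset G C) (F : X -> Y).
Hypothesis bF : fiberwise_bijective F.

(** The bijection X/A -> Y/C is also G-equivariant, so the translates by any g
    can be compared, not only those by 1. *)
Lemma fiberwise_bijective_transport x y g c :
  F y = ga_act g c (F x) -> exists a, y = ga_act g a x.
Proof.
have [FE injF _] := bF; move=> yx.
have [|a ->] := injF (ga_act g 0 x) y c; last first.
  by exists a; rewrite -ga_actM mul1g addr0.
by rewrite FE raddf0 yx -ga_actM mul1g addr0.
Qed.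

Lemma stab_pair_fiberwise x : stab_pair (F x) = push_charpair f (stab_pair x).
Proof.
have [FE _ _] := bF.
have key g : g \in cp_grp (stab_pair x) ->
    ga_act g (f (cp_hom (stab_pair x) g)) (F x) = F x.
  by move=> gx; rewrite -FE; congr F; apply/stab_pairP.
have grpE g : (g \in cp_grp (stab_pair (F x))) = (g \in cp_grp (stab_pair x)).
  apply/idP/idP => [gx|/key/stab_pairP[] //].
  have /esym/fiberwise_bijective_transport[a /esym/stab_pairP[] //] :
    ga_act g (cp_hom (stab_pair (F x)) g) (F x) = F x by apply/stab_pairP.
apply: charpair_eq => [|g]; first by apply/setP=> g; rewrite grpE.
rewrite grpE => /key/stab_pairP[_ <-].
by rewrite /cp_hom /= !ffunE.
Qed.

(** A fiberwise bijection matches the G-orbits of X/A with those of Y/C, hence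
    maps a transversal of X to one of Y, and it pushes stabilizing pairs forward
    along f; the two classes then agree term by term. *)
Lemma fiber_change_fib_class : fiber_change f (fib_class X) = fib_class Y.
Proof.
have [FE _ surF] := bF; have [s ts] := ex_transversal X.
have oE x y : orbit_rel (F x) (F y) = orbit_rel x y.
  apply/orbit_relP/orbit_relP => -[g].
    by case=> c /fiberwise_bijective_transport[a ->]; exists g, a.
  by case=> a ->; exists g, (f a).
have tFs : Defs.transversal (map F s).
  case: ts => us sP; split.
    rewrite -map_comp; elim: s us {sP} => //= x s IHs /andP[xs /IHs ->].
    rewrite andbT; apply: contra xs => /mapP[y ys /eqP].
    rewrite /= orbit_pi oE -orbit_pi => /eqP ->.
    exact: (map_f (\pi_(orbit_space X))).
  move=> y; have [x [c ->]] := surF y; have [z zs zx] := sP x.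
  exists (F z); first exact: map_f.
  rewrite -oE in zx; apply: orbit_rel_trans zx _.
  by apply/orbit_relP; exists 1%g, c.
rewrite (fib_classE ts) (fib_classE tFs) big_map raddf_sum.
by apply: eq_bigr => x _; rewrite stab_pair_fiberwise /= fiber_changeE.
Qed.

End Stabilizers.

Definition coset_push (p : charpair G A) (z : transitive_fibset p) :
    transitive_fibset (push_charpair f p) :=
  \pi_(coset_space (push_charpair f p)) ((repr z).1, f (repr z).2).

Lemma coset_pushE p z :
  coset_push (\pi_(coset_space p) z) =
  \pi_(coset_space (push_charpair f p)) (z.1, f z.2).
Proof.
rewrite /coset_push; apply/eqP; rewrite coset_pi.
have : coset_rel p (repr (\pi_(coset_space p) z)) z by rewrite -coset_pi reprK.
move: (repr _) => y /coset_relP[k kK ->]; apply/coset_relP; exists k => //.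
by rewrite /= raddfD /cp_hom /= ffunE.
Qed.

Lemma coset_push_fiberwise p : fiberwise_bijective (@coset_push p).
Proof.
split.
- move=> g a; elim/quotW=> z.
  by rewrite [ga_act g a _]coset_actE !coset_pushE [RHS]coset_actE /= raddfD.
- elim/quotW=> z; elim/quotW=> w c; rewrite !coset_pushE => /esym.
  rewrite [LHS]coset_actE /= mul1g => /eqP; rewrite coset_pi.
  case/coset_relP=> k kK [wz _]; exists (w.2 - cp_hom p k - z.2); apply/esym.
  rewrite [LHS]coset_actE; apply/eqP; rewrite coset_pi; apply/coset_relP.
  exists k => //=.
  by rewrite mul1g -wz !subrK -surjective_pairing.
- elim/quotW=> y; exists (\pi_(coset_space p) (y.1, 0)), y.2.
  rewrite coset_pushE [RHS]coset_actE /= mul1g raddf0 addr0.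
  by rewrite -surjective_pairing.
Qed.

End OneGroup.

End FiberwiseBijection.

(** * Stabilizers in tensor products *)

Section TensorStabilizers.
Variables (G H : finGroupType) (U : biset H G).

(** An element a of A fixes the class of (u, x) exactly when, for some g fixing
    u, the pair (g, a) fixes x, that is, g lies in K and a = phi g; hence the
    fiber stabilizer is the image under phi of the elements of K fixing u. *)
Lemma tensor_predP (A : zmodType) (X : fibset G A) (u : U) (x : X) :
  @tensor_pred H G A U X (\pi_(balanced_space U X) (u, x)) <->
  {in cp_grp (stab_pair x),
    forall g, bs_ract u g = u -> cp_hom (stab_pair x) g = 0}.
Proof.
split=> [/asboolP free g gx ug|van].
  apply: free; rewrite [LHS]balanced_actE bs_lact1 /=; apply/eqP.
  rewrite balanced_pi; apply/balanced_relP; exists g; split=> //=.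
  by rewrite -ga_actM mulg1 add0r; apply/esym/stab_pairP.
apply/asboolP => a; rewrite [LHS]balanced_actE bs_lact1 /= => /eqP.
rewrite balanced_pi => /balanced_relP[g /= [ug]].
by rewrite -ga_actM mulg1 add0r => /esym/stab_pairP[gx ->]; apply: van.
Qed.

Lemma cp_hom_torsion (A : zmodType) (p : charpair G A) g :
  g \in cp_grp p -> torsion (cp_hom p g).
Proof.
move=> gp; exists #[g]%g; first exact: order_gt0.
rewrite -(cp_hom1 p) -(expg_order g); elim: #[g]%g => [|n IHn].
  by rewrite expg0 cp_hom1.
by rewrite expgS cp_homM ?groupX // mulrS IHn.
Qed.

Variables (A C : zmodType) (f : {additive A -> C}).
Hypothesis inj_tor :
  forall a b : A, torsion a -> torsion b -> f a = f b -> a = b.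
Variables (X : fibset G A) (Y : fibset G C) (F : X -> Y).
Hypothesis bF : fiberwise_bijective f F.

Definition balanced_push (q : balanced_product U X) : balanced_product U Y :=
  \pi_(balanced_space U Y) ((repr q).1, F (repr q).2).

Lemma balanced_pushE p :
  balanced_push (\pi_(balanced_space U X) p) =
  \pi_(balanced_space U Y) (p.1, F p.2).
Proof.
have [FE _ _] := bF; rewrite /balanced_push; apply/eqP; rewrite balanced_pi.
have : balanced_rel (repr (\pi_(balanced_space U X) p)) p.
  by rewrite -balanced_pi reprK.
move: (repr _) => -[u x]; case: p => v y /balanced_relP[g /= [-> ->]].
by apply/balanced_relP; exists g; rewrite /= FE raddf0.
Qed.

Lemma balanced_push_fiberwise : fiberwise_bijective f balanced_push.
Proof.
have [FE _ surF] := bF; split.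
- move=> h a; elim/quotW=> p; rewrite [ga_act h a _]balanced_actE.
  by rewrite !balanced_pushE [RHS]balanced_actE /= FE.
- elim/quotW=> -[u x]; elim/quotW=> -[v y] c; rewrite !balanced_pushE => /esym.
  rewrite [LHS]balanced_actE bs_lact1 /= => /eqP.
  rewrite balanced_pi => /balanced_relP[g /= [->]].
  rewrite -ga_actM add0r mulg1 => /(fiberwise_bijective_transport bF)[a ->].
  exists a.
  rewrite [RHS]balanced_actE bs_lact1 /=; apply/esym/eqP.
  rewrite balanced_pi; apply/balanced_relP; exists g; split=> //=.
  by rewrite -ga_actM mulg1 add0r.
- elim/quotW=> -[u y]; have [x [c ->]] := surF y.
  exists (\pi_(balanced_space U X) (u, x)), c.
  by rewrite balanced_pushE [RHS]balanced_actE bs_lact1.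
Qed.

(** The injectivity of f on torsion is applied here to the values of phi and
    to 0: an element g fixing u has phi g = 0 as soon as f (phi g) = 0. *)
Lemma tensor_pred_push q : tensor_pred (balanced_push q) = tensor_pred q.
Proof.
elim/quotW: q => -[u x]; rewrite balanced_pushE /=.
apply/idP/idP => /tensor_predP van; apply/tensor_predP => g;
  have := van g; rewrite (stab_pair_fiberwise bF) /cp_grp /= -/(cp_grp _).
- move=> {}van gx ug; apply: inj_tor; first exact: cp_hom_torsion.
    by exists 1%N; rewrite ?mul0rn.
  by have := van gx ug; rewrite /cp_hom /= ffunE raddf0.
- by move=> {}van gx ug; rewrite /cp_hom /= ffunE -/(cp_hom _ _) van ?raddf0.
Qed.

Lemma tensor_push_subproof (z : tensor U X) :
  tensor_pred (balanced_push (val z)).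
Proof. by rewrite tensor_pred_push; apply: valP. Qed.

Definition tensor_push (z : tensor U X) : tensor U Y :=
  exist _ (balanced_push (val z)) (tensor_push_subproof z).

Lemma tensor_push_fiberwise : fiberwise_bijective f tensor_push.
Proof.
have [FE injF surF] := balanced_push_fiberwise; split.
- by move=> h a z; apply: val_inj; apply: FE.
- move=> z w c /(congr1 val)/injF[a wz]; exists a; exact: val_inj.
- move=> w; have [q [c wq]] := surF (val w).
  have qP : tensor_pred q.
    rewrite -tensor_pred_push -(ga_actK 1%g c (balanced_push q)) -wq.
    exact/tensor_pred_act/valP.
  by exists (exist _ q qP), c; apply: val_inj.
Qed.

End TensorStabilizers.

(** * Detecting a torsion element of the kernel *)

Section CyclicObstruction.
Variables (A : zmodType) (t : A) (m : nat).
Hypothesis tm : t *+ m.+1 = 0.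

Lemma mulrn_modn k : t *+ (k %% m.+1) = t *+ k.
Proof.
by rewrite [in RHS](divn_eq k m.+1) mulrnDr mulnC mulrnA tm mul0rn add0r.
Qed.

Lemma cyclic_charpair_subproof :
  is_charpair ([set: 'I_m.+1]%G, [ffun i : 'I_m.+1 => t *+ i]).
Proof.
apply/is_charpairP; split=> [i j _ _|i]; last by rewrite inE.
by rewrite !ffunE /= mulrn_modn mulrnDr.
Qed.

Definition cyclic_charpair : charpair 'I_m.+1 A :=
  CharPair cyclic_charpair_subproof.

End CyclicObstruction.

Definition point_biset (H G : finGroupType) : biset H G :=
  @Biset H G unit (fun _ u => u) (fun u _ => u) (fun=> erefl)
    (fun _ _ _ => erefl) (fun=> erefl) (fun _ _ _ => erefl)
    (fun _ _ _ => erefl).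

(** Every element of G fixes the point, so the stabilizer criterion asks phi to
    vanish on all of K.  It suffices to test the base point, since the other
    points have conjugate stabilizing pairs. *)
Lemma point_tensor_emptyP (H G : finGroupType) (A : zmodType)
    (p : charpair G A) :
  (tensor (point_biset H G) (transitive_fibset p) -> False) <->
  ~ {in cp_grp p, forall g, cp_hom p g = 0}.
Proof.
split=> [X0 van|nvan [q qP]].
  have qP : tensor_pred (\pi_(balanced_space (point_biset H G)
      (transitive_fibset p)) (tt, base_coset p)).
    by apply/tensor_predP => g; rewrite stab_pair_base => /van.
  exact: X0 (exist (fun q => tensor_pred q) _ qP).
apply: nvan => g gp; elim/quotW: q qP => -[u x] qP.
have := (@tensor_predP _ _ _ _ (transitive_fibset p) u x).1 qP.
have /orbit_relP[h [a ->]] := coset_transitive x.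
rewrite stab_pair_act stab_pair_base => /(_ (g ^ h^-1)%g).
by rewrite /cp_hom /cp_grp /= ffunE memJ_conjg conjgKV; apply.
Qed.

Theorem theorem4p5 (A C : zmodType) (f : {additive A -> C}) :
  biset_functor_morphism
    (fun G : finGroupType =>
       (@fiber_change A C f G : {additive burnside A G -> burnside C G}))
  <->
  (forall a b : A, torsion a -> torsion b -> f a = f b -> a = b).
Proof.
split=> [fU a b [n n_gt0 an] [k k_gt0 bk] fab|inj_tor G H U].
  apply/eqP; rewrite -subr_eq0; apply/eqP; set t := a - b.
  have [m tm] : exists m, t *+ m.+1 = 0.
    exists (n * k).-1; rewrite prednK ?muln_gt0 ?n_gt0 //.
    by rewrite mulrnBl mulrnA an mul0rn mulnC mulrnA bk mul0rn subrr.
  have ft : f t = 0 by rewrite raddfB fab subrr.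
  pose p := cyclic_charpair tm; apply: contrapT => t_neq0.
  have := fU _ _ (point_biset 'I_m.+1 'I_m.+1) (basis_class p).
  rewrite /= fiber_changeE -!fib_class_transitive !burnside_bisetE.
  have /fib_class_eq0P-> :
      tensor (point_biset 'I_m.+1 'I_m.+1) (transitive_fibset p) -> False.
    (* The generator is inZp 1 rather than 1: the group 'I_1 is allowed, and
       there the value 1 %% 1 = 0 still gives t, because then t = 0. *)
    apply/point_tensor_emptyP => /(_ (inZp 1) (finset.in_setT _)).
    by rewrite /cp_hom /= ffunE /= mulrn_modn.
  rewrite raddf0 => /esym/fib_class_eq0P/point_tensor_emptyP; apply=> i _.
  by rewrite /cp_hom /= !ffunE raddfMn ft mul0rn.
apply: (@additive_eq_basis _ _ _ (fiber_change f (G:=H) \o burnside_biset U)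
  (burnside_biset U \o fiber_change f (G:=G))) => p /=.
rewrite fiber_changeE -!fib_class_transitive !burnside_bisetE.
exact: fiber_change_fib_class
  (tensor_push_fiberwise U inj_tor (coset_push_fiberwise f p)).
Qed.
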